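(* (i) For every $n\ge 1$, $|\mathcal{DRS}_n(321)|=C_n$, the $n$th Catalan number $C_n=\frac{1}{n+1}\binom{2n}{n}$. (ii) $|\mathcal{DRS}_4(123)|=5$, $|\mathcal{DRS}_5(123)|=3$, and $|\mathcal{DRS}_n(123)|=2$ for all $n\ge 6$.
   Context: For $\sigma\in\mathfrak{S}_n$, a double descent is an index $i$ with $\sigma_i>\sigma_{i+1}>\sigma_{i+2}$. The permutation $\sigma$ is simsun if for every $k$, the subword of $\sigma$ consisting of the letters in $\{1,\dots,k\}$ (in the order they appear in $\sigma$) has no double descent. For $\omega\in\mathfrak{S}_t$, $\sigma$ contains an $\omega$-pattern if there are indices $i_1<\cdots<i_t$ with $\sigma_{i_j}<\sigma_{i_k}$ iff $\omega_j<\omega_k$; otherwise $\sigma$ avoids $\omega$. $\mathcal{DRS}_n(\omega)$ is the set of $\sigma\in\mathfrak{S}_n$ such that $\sigma$ is $\omega$-avoiding and simsun and $\sigma^{-1}$ is simsun. *)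

(* Defs.v *)
(* Permutations of {1, ..., n} are shifted to permutations of
   'I_n = {0, ..., n-1}: a letter v of the mathematics is the value v - 1. *)
From HB Require Import structures.
From mathcomp Require Import all_boot all_fingroup.

Set Implicit Arguments.
Unset Strict Implicit.
Unset Printing Implicit Defensive.

Definition word (n : nat) (s : 'S_n) : seq nat := [seq val (s i) | i <- enum 'I_n].

Definition double_descent (w : seq nat) (i : nat) : bool :=
  (i.+2 < size w) && (nth 0 w i.+2 < nth 0 w i.+1 < nth 0 w i).

Definition has_double_descent (w : seq nat) : bool :=
  [exists i : 'I_(size w), double_descent w i].

(* The letters 1, ..., k are the values x < k after the shift. *)
Definition subword (k : nat) (w : seq nat) : seq nat := [seq x <- w | x < k].

Definition simsun (n : nat) (s : 'S_n) : bool :=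
  [forall k : 'I_n.+1, ~~ has_double_descent (subword k (word s))].

Definition contains_pattern (t n : nat) (w : 'S_t) (s : 'S_n) : bool :=
  [exists f : {ffun 'I_t -> 'I_n},
     [forall j : 'I_t, forall k : 'I_t, (j < k) ==> (f j < f k)] &&
     [forall j : 'I_t, forall k : 'I_t, (s (f j) < s (f k)) == (w j < w k)]].

Definition avoids (t n : nat) (w : 'S_t) (s : 'S_n) : bool :=
  ~~ contains_pattern w s.

Definition DRS (t : nat) (w : 'S_t) (n : nat) : {set 'S_n} :=
  [set s | [&& avoids w s, simsun s & simsun s^-1%g]].

Definition perm123 : 'S_3 := 1%g.
Definition perm321 : 'S_3 := perm (@rev_ord_inj 3).

(* The division is exact. *)
Definition catalan (n : nat) : nat := 'C(2 * n, n) %/ n.+1.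

(* Main.v *)
(* A double descent is a 321-pattern, and 321 is an involution, so the simsun
   conditions are vacuous for 321-avoiding permutations.  These are counted by
   inserting the maximum: it may be placed exactly where the letters to its
   right are increasing, which yields the recurrence of the ballot numbers.

   For 123, deleting the maximum preserves all three conditions.  From size 6 on
   the only survivors are, in one-line notation with letters 0, ..., n - 1,
     A_n = (n-2)(n-1)(n-4)(n-3)...   and   B_n = (n-1) A_(n-1);
   the new maximum n can only be put in front of A_n, giving B_(n+1), or in the
   second position of B_n, giving A_(n+1). *)
Require Import Defs.
From HB Require Import structures.
From mathcomp Require Import all_boot all_fingroup.
From mathcomp Require Import zify.

Set Implicit Arguments.
Unset Strict Implicit.
Unset Printing Implicit Defensive.

(** * Monotone triples and double descents in words *)

Fixpoint triple_free (r : rel nat) (w : seq nat) : bool :=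
  if w is x :: w' then
    pairwise (fun y z => ~~ (r x y && r y z)) w' && triple_free r w'
  else true.

(** A structural recursion, unlike the existential over ordinals in [has_double_descent], evaluates
    under [vm_compute]. *)
Fixpoint no_double_descent (w : seq nat) : bool :=
  if w is x :: w' then
    (if w' is y :: z :: _ then ~~ (z < y < x) else true) && no_double_descent w'
  else true.

Definition simsun_word (w : seq nat) : bool :=
  all (fun k => no_double_descent (subword k w)) (iota 0 (size w).+1).

Definition inverse_word (w : seq nat) : seq nat :=
  [seq index i w | i <- iota 0 (size w)].

Definition words (n : nat) : seq (seq nat) := permutations (iota 0 n).

Lemma triple_freeP r w :
  reflect (forall i j k, i < j -> j < k -> k < size w ->
             ~~ (r (nth 0 w i) (nth 0 w j) && r (nth 0 w j) (nth 0 w k)))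
          (triple_free r w).
Proof.
apply: (iffP idP) => [|H].
  elim: w => [|x w IH] //= /andP[Hp /IH{}IH] [|i] [|j] [|k] //= ij jk kw.
    by move/(pairwiseP 0): Hp => /(_ j k); apply => //; rewrite inE; lia.
  by apply: IH.
elim: w H => [|x w IH] //= H; apply/andP; split.
  apply/(pairwiseP 0) => j k; rewrite !inE => jw kw jk.
  by apply: (H 0 j.+1 k.+1).
by apply: IH => i j k ij jk kw; apply: (H i.+1 j.+1 k.+1).
Qed.

Lemma triple_free_filter r p w : triple_free r w -> triple_free r (filter p w).
Proof.
elim: w => //= x w IH /andP[Hp /IH Hw].
by case: (p x) => //=; rewrite Hw andbT; apply: pairwise_filter.
Qed.

Lemma no_double_descentP w : reflect (forall i, ~~ double_descent w i) (no_double_descent w).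
Proof.
apply: (iffP idP) => [|H].
  elim: w => [|x w IH] //= /andP[Hx /IH{}IH] [|i]; last exact: IH.
  by case: w Hx {IH} => [|y [|z w]].
elim: w H => //= x w IH H; apply/andP; split; last by apply: IH => i; apply: (H i.+1).
by case: w H {IH} => [|y [|z w]] // /(_ 0).
Qed.

Lemma has_double_descentE w : has_double_descent w = ~~ no_double_descent w.
Proof.
apply/existsP/negP => [[i Hi] /no_double_descentP /(_ i)|H]; first by rewrite Hi.
have /allPn[i] : ~~ all (fun i => ~~ double_descent w i) (iota 0 (size w)).
  apply/negP => /allP Ha; apply: H; apply/no_double_descentP => i.
  case: (ltnP i (size w)) => iw; first by apply: Ha; rewrite mem_iota.
  by rewrite /double_descent; apply/negP => /andP[]; lia.
by rewrite mem_iota negbK => /= iw Hi; exists (Ordinal iw).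
Qed.

Lemma triple_free_no_double_descent w : triple_free gtn w -> no_double_descent w.
Proof.
move/triple_freeP => H; apply/no_double_descentP => i; apply/negP.
by case/andP=> Hs /andP[H1 H2]; have := H _ _ _ (ltnSn i) (ltnSn i.+1) Hs; rewrite /= H1 H2.
Qed.

Lemma no_double_descent_mono (f : nat -> nat) w : {mono f : x y / x < y} ->
  no_double_descent (map f w) = no_double_descent w.
Proof.
by move=> Hf; elim: w => //= x w ->; case: w => [|y [|z w]] //=; rewrite !Hf.
Qed.

Lemma no_double_descent_catl u v : no_double_descent (u ++ v) -> no_double_descent u.
Proof.
elim: u => //= x u IH /andP[H /IH ->]; rewrite andbT.
by case: u H {IH} => [|y [|z u]].
Qed.

(** No double descent contains both ends of an ascent, so each one lies up to [x] or from [y] on. *)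
Lemma no_double_descent_ascent u x y v : x < y ->
  no_double_descent (u ++ [:: x, y & v])
  = no_double_descent (rcons u x) && no_double_descent (y :: v).
Proof.
move=> xy; elim: u => [|a u IH].
  by case: v => [|z v] //=; rewrite (ltnNge y x) (ltnW xy) andbF.
rewrite [LHS]/= IH /= andbA; congr (_ && _ && _).
case: u {IH} => [|b [|c u]] //=.
by rewrite (ltnNge y x) (ltnW xy).
Qed.

Lemma subword_all k w : all (gtn k) w -> subword k w = w.
Proof. by move/all_filterP. Qed.

Lemma simsun_wordP w : all (gtn (size w)) w ->
  reflect (forall k, no_double_descent (subword k w)) (simsun_word w).
Proof.
move=> Hw; apply: (iffP allP) => [H k|H k _]; last exact: H.
have [kw|kw] := leqP k (size w); first by apply: H; rewrite mem_iota.
have: no_double_descent (subword (size w) w) by apply: H; rewrite mem_iota /=.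
rewrite !subword_all //; apply: sub_all Hw => x /= ; lia.
Qed.

(** * One-line words, insertion of the maximum, and inverses *)

Lemma mem_words n w : (w \in words n) = perm_eq w (iota 0 n).
Proof. exact: mem_permutations. Qed.

Lemma size_words n w : w \in words n -> size w = n.
Proof. by rewrite mem_words => /perm_size; rewrite size_iota. Qed.

Lemma words_uniq n w : w \in words n -> uniq w.
Proof. by rewrite mem_words => /perm_uniq ->; apply: iota_uniq. Qed.

Lemma words_mem n w i : w \in words n -> (i \in w) = (i < n).
Proof. by rewrite mem_words => /perm_mem ->; rewrite mem_iota. Qed.

Lemma words_lt n w : w \in words n -> all (gtn n) w.
Proof. by move=> Hw; apply/allP => x; rewrite (words_mem _ Hw). Qed.

Lemma wordsS_split n w : w \in words n.+1 ->
  exists a b, w = a ++ n :: b /\ a ++ b \in words n.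
Proof.
move=> Hw; have: n \in w by rewrite (words_mem _ Hw).
move=> /splitPr def_w; case: def_w Hw => a b Hw; exists a, b; split=> //.
rewrite !mem_words in Hw *.
have Hn : perm_eq (n :: a ++ b) (a ++ n :: b).
  by rewrite perm_sym -(cat1s n b) perm_catCA.
have Hi : perm_eq (iota 0 n.+1) (n :: iota 0 n) by rewrite -addn1 iotaD perm_catC.
by rewrite -(perm_cons n) (perm_trans Hn (perm_trans Hw Hi)).
Qed.

Lemma words_insert n a b : a ++ b \in words n -> a ++ n :: b \in words n.+1.
Proof.
rewrite !mem_words => H; rewrite -(cat1s n b) perm_catCA -addn1 iotaD.
by rewrite perm_sym perm_catC perm_cons perm_sym.
Qed.

Lemma size_inverse_word w : size (inverse_word w) = size w.
Proof. by rewrite size_map size_iota. Qed.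

Lemma inverse_word_lt n w : w \in words n -> all (gtn n) (inverse_word w).
Proof.
move=> Hw; apply/allP => x /mapP[i]; rewrite mem_iota /= (size_words Hw) => Hi ->.
by rewrite -[n in X in _ < X](size_words Hw) index_mem (words_mem _ Hw).
Qed.

(** The inverse lists positions: those from [size a] on move up by one, and the position of the new
    maximum comes last. *)
Lemma inverse_word_insert n a b : a ++ b \in words n ->
  inverse_word (a ++ n :: b)
  = rcons (map (bump (size a)) (inverse_word (a ++ b))) (size a).
Proof.
move=> Hw; have Hn : n \notin a ++ b by rewrite (words_mem _ Hw) ltnn.
have Hs := size_words Hw; rewrite size_cat in Hs.
rewrite /inverse_word !size_cat /= addnS Hs -addn1 iotaD map_cat /= cats1.
rewrite mem_cat negb_or in Hn; case/andP: Hn => Ha Hb.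
congr rcons; last by rewrite index_cat (negPf Ha) /= eqxx addn0.
rewrite -map_comp; apply/eq_in_map => i; rewrite mem_iota /= => Hi.
have ni : (n == i) = false by apply/eqP; lia.
rewrite !index_cat /= ni /bump; case: ifP => Hia.
  by move: Hia; rewrite -index_mem ltnNge => /negPf ->.
by rewrite leq_addr addnS.
Qed.

(** * Translation from permutations to words *)

Section Words.
Variable n : nat.
Implicit Type s : 'S_n.

Lemma size_word s : size (word s) = n.
Proof. by rewrite size_map -cardE card_ord. Qed.

Lemma nth_word s (i : 'I_n) : nth 0 (word s) i = s i.
Proof. by rewrite (nth_map i) ?size_enum_ord // nth_ord_enum. Qed.

Lemma word_uniq s : uniq (word s).
Proof. by rewrite map_inj_uniq ?enum_uniq // => i j /val_inj/perm_inj. Qed.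

Lemma word_words s : word s \in words n.
Proof.
rewrite mem_words; apply: uniq_perm (word_uniq s) (iota_uniq _ _) _.
move=> x; rewrite mem_iota /=; apply/mapP/idP => [[i _ ->]|Hx]; first exact: ltn_ord.
by exists ((s^-1)%g (Ordinal Hx)); rewrite ?mem_enum // permKV.
Qed.

Lemma word_inj : injective (@word n).
Proof.
move=> s t E; apply/permP => i; apply: val_inj.
by rewrite /= -!nth_word E.
Qed.

Lemma word_inv s : word s^-1%g = inverse_word (word s).
Proof.
apply: (@eq_from_nth _ 0); first by rewrite size_inverse_word !size_word.
move=> i; rewrite size_word => Hi; rewrite -[i]/(val (Ordinal Hi)) nth_word /=.
rewrite (nth_map 0) ?size_iota ?size_word // nth_iota // add0n.
have {2}-> : i = nth 0 (word s) (s^-1%g (Ordinal Hi)) by rewrite nth_word permKV.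
by rewrite index_uniq ?word_uniq // size_word.
Qed.

(** The words of permutations are distinct members of [words n], and both lists have length n!, so
    they agree up to order. *)
Lemma card_word (Q : pred (seq nat)) : #|[set s : 'S_n | Q (word s)]| = count Q (words n).
Proof.
have Hu : uniq [seq word s | s : 'S_n <- enum 'S_n].
  by rewrite map_inj_uniq ?enum_uniq //; apply: word_inj.
have Hp : perm_eq [seq word s | s : 'S_n <- enum 'S_n] (words n).
  apply: uniq_perm (permutations_uniq _) _ => //.
  have Hsub : {subset [seq word s | s : 'S_n <- enum 'S_n] <= words n}.
    by move=> w /mapP[s _ ->]; apply: word_words.
  suff Hs : size (words n) <= size [seq word s | s : 'S_n <- enum 'S_n].
    exact: (uniq_min_size Hu Hsub Hs).2.
  rewrite size_permutations ?iota_uniq // size_iota size_map.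
  by rewrite -[X in X <= _](card_Sn n) cardE.
rewrite -(seq.permP Hp) count_map -size_filter cardE; congr size.
by rewrite !enumT /enum_mem; apply: eq_filter => s; rewrite !inE.
Qed.

Lemma simsun_wordE s : simsun s = simsun_word (word s).
Proof.
apply/forallP/allP => [H k|H k].
  rewrite mem_iota size_word /= add0n => Hk.
  by have := H (Ordinal Hk); rewrite has_double_descentE negbK.
by rewrite has_double_descentE negbK; apply: H; rewrite mem_iota size_word ltn_ord.
Qed.

End Words.

Lemma avoids_word n (w : 'S_3) (s : 'S_n) (r : rel nat) :
    r = ltn \/ r = gtn -> (forall j k, (w j < w k) = r j k) ->
  avoids w s = triple_free r (word s).
Proof.
move=> Hr Hw; apply/idP/triple_freeP => [Ha i j k ij jk|H].
  rewrite size_word => kn; apply: contra Ha => Hijk; apply/existsP.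
  have jn := ltn_trans jk kn; have iN := ltn_trans ij jn.
  move: Hijk; rewrite -[i]/(val (Ordinal iN)) -[j]/(val (Ordinal jn)).
  rewrite -[k]/(val (Ordinal kn)) !nth_word => Hijk.
  (* The embedding sends 0, 1, 2 to i, j, k; the default is never reached. *)
  exists [ffun x : 'I_3 => nth (Ordinal iN) [:: Ordinal iN; Ordinal jn; Ordinal kn] x].
  apply/andP; split; apply/forallP => -[[|[|[|x]]] Hx] //;
    apply/forallP => -[[|[|[|y]]] Hy] //; rewrite !ffunE ?Hw /= ?ltnn //;
    by [exact: ltn_trans jk | case: Hr Hijk => -> /= /andP[]; lia].
apply/negP => /existsP[f /andP[/forallP Hlt /forallP Hf]].
pose o x (Hx : x < 3) := Ordinal Hx.
have lt01 := forallP (Hlt (@o 0 isT)) (@o 1 isT).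
have lt12 := forallP (Hlt (@o 1 isT)) (@o 2 isT).
have Hr3 : r 0 1 && r 1 2 \/ r 1 0 && r 2 1 by case: Hr => ->; [left|right].
have := H _ _ _ lt01 lt12; rewrite size_word !nth_word ltn_ord => /(_ isT) /negP; apply.
(* The pairs 01 and 12 serve [ltn], the reversed pairs 10 and 21 serve [gtn]. *)
have f01 := eqP (forallP (Hf (@o 0 isT)) (@o 1 isT)).
have f12 := eqP (forallP (Hf (@o 1 isT)) (@o 2 isT)).
have f10 := eqP (forallP (Hf (@o 1 isT)) (@o 0 isT)).
have f21 := eqP (forallP (Hf (@o 2 isT)) (@o 1 isT)).
rewrite !Hw in f01 f12 f10 f21.
by case: Hr f01 f12 f10 f21 => -> /= f01 f12 f10 f21; rewrite ?f01 ?f12 ?f10 ?f21.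
Qed.

Lemma avoids123 n (s : 'S_n) : avoids perm123 s = triple_free ltn (word s).
Proof. by apply: avoids_word => [|j k]; [left | rewrite !perm1]. Qed.

Lemma avoids321 n (s : 'S_n) : avoids perm321 s = triple_free gtn (word s).
Proof.
apply: avoids_word => [|j k]; first by right.
by rewrite !permE /=; have := ltn_ord j; have := ltn_ord k; lia.
Qed.

(** * Counting 321-avoiding words by ballot numbers *)

Lemma triple_free_gtn_inv n (s : 'S_n) :
  triple_free gtn (word s) -> triple_free gtn (word s^-1%g).
Proof.
move/triple_freeP => H; apply/triple_freeP => i j k ij jk; rewrite size_word => kn.
have jn := ltn_trans jk kn; have iN := ltn_trans ij jn.
rewrite -[i]/(val (Ordinal iN)) -[j]/(val (Ordinal jn)) -[k]/(val (Ordinal kn)) !nth_word.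
(* Positions and values swap roles: the letters k > j > i of [s] occur in this order, at the
   positions given by the inverse. *)
apply/negP => /andP[/= Hij Hjk]; have := H _ _ _ Hjk Hij.
by rewrite size_word !nth_word ltn_ord !permKV /= ij jk => /(_ isT).
Qed.

Lemma triple_free_gtn_simsun n (s : 'S_n) : triple_free gtn (word s) -> simsun s.
Proof.
rewrite simsun_wordE => H; apply/allP => k _.
exact/triple_free_no_double_descent/triple_free_filter.
Qed.

Lemma card_DRS321 n : #|DRS perm321 n| = count (triple_free gtn) (words n).
Proof.
rewrite -card_word; apply: eq_card => s; rewrite !inE avoids321.
apply/andP/idP => [[] //|H]; split=> //.
by rewrite !triple_free_gtn_simsun ?triple_free_gtn_inv.
Qed.

(** The new maximum can only be the first letter of a decreasing triple, so exactly the descending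
    pairs in [b] are harmful. Distinctness of letters makes their absence a strict sorting. *)
Lemma triple_free_gtn_insert n a b : a ++ b \in words n ->
  triple_free gtn (a ++ n :: b) = triple_free gtn (a ++ b) && sorted ltn b.
Proof.
move=> Hw; have Hlt := words_lt Hw; have Hu := words_uniq Hw.
elim: a Hlt Hu {Hw} => [|x a IH] /= => [Hb Ub|/andP[xn Hab] /andP[Hx Uab]].
  rewrite andbC sorted_pairwise; last exact: ltn_trans.
  congr (_ && _); elim: b Hb Ub => //= y b IH /andP[yn Hb] /andP[Hy Ub].
  rewrite IH //; congr (_ && _); apply/eq_in_all => z Hz; rewrite /= yn /= -leqNgt.
  by rewrite leq_eqVlt; case: eqP => // E; rewrite E Hz in Hy.
rewrite IH // !andbA; congr (_ && _ && _).
rewrite !pairwise_cat /= allrel_consr.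
have -> : all (fun y => ~~ ((y < x) && (n < y))) a.
  by apply/allP => y Hy; move/allP: Hab => /(_ y); rewrite mem_cat Hy /= => /(_ isT); lia.
have -> //: all (fun y => ~~ ((n < x) && (y < n))) b.
by apply/allP => y _; lia.
Qed.

Definition max_insertions (n : nat) : seq (seq nat) :=
  [seq take i w ++ n :: drop i w | w <- words n, i <- iota 0 n.+1].

(** Every word of [words n.+1] is an insertion, and both lists have (n+1)! entries. Uniqueness of
    the first list therefore carries over to the second. *)
Lemma perm_max_insertions n : perm_eq (words n.+1) (max_insertions n).
Proof.
have Hu : uniq (words n.+1) by apply: permutations_uniq.
have Hsub : {subset words n.+1 <= max_insertions n}.
  move=> w /wordsS_split[a [b [-> Hab]]].
  apply/allpairsP; exists (a ++ b, size a); split=> //.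
    by rewrite mem_iota -(size_words Hab) size_cat /=; lia.
  by rewrite /= take_size_cat // drop_size_cat.
have Hs : size (max_insertions n) <= size (words n.+1).
  by rewrite size_allpairs !size_permutations ?iota_uniq // !size_iota mulnC.
have Hi := uniq_min_size Hu Hsub Hs.
apply: uniq_perm => //; last exact: Hi.2.
by rewrite -(eq_uniq Hi.1 Hi.2).
Qed.

(** The parameter t closes the recurrence: by [triple_free_gtn_insert], slot i of w admits the
    maximum exactly when [sorted_tail i w]. *)
Definition sorted_tail (t : nat) (w : seq nat) : bool :=
  triple_free gtn w && sorted ltn (drop t w).

(** For i < t the new tail is a suffix of [drop i w], hence sorted. For t <= i the maximum lies in
    the tail and, as i < n, precedes a smaller letter. *)
Lemma sorted_tail_insert n t i w : w \in words n -> t <= n -> i < n ->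
  sorted_tail t (take i w ++ n :: drop i w) = (i < t) && sorted_tail i w.
Proof.
move=> Hw tn iN; have Hlt := words_lt Hw; have Hs := size_words Hw.
rewrite /sorted_tail triple_free_gtn_insert ?cat_take_drop //.
have Htk : size (take i w) = i by rewrite size_takel // Hs ltnW.
rewrite drop_cat Htk; have [it|ti] := ltnP i t.
  rewrite ltnNge (ltnW it) /=; have -> : t - i = (t - i.+1).+1 by lia.
  case: (boolP (sorted ltn (drop i w))) => [H|]; rewrite ?andbF //=.
  by rewrite drop_sorted ?andbT.
apply/negbTE; rewrite negb_and; apply/orP; right.
have Hns : ~~ sorted ltn (n :: drop i w).
  case E : (drop i w) (size_drop i w) => [|x v]; first by rewrite Hs /=; lia.
  move=> _; have : x \in w by apply: (mem_drop (n0 := i)); rewrite E inE eqxx.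
  by move/(allP Hlt) => /= xn; rewrite ltnNge (ltnW xn).
case: ltnP => [_|it]; first by apply: contra Hns => /cat_sorted2[].
by have -> : t - i = 0 by lia.
Qed.

Lemma sorted_tail_insert_last n t w : w \in words n -> t <= n ->
  sorted_tail t (rcons w n) = sorted_tail t w.
Proof.
move=> Hw tn; have Hlt := words_lt Hw.
rewrite /sorted_tail -{1}cats1 triple_free_gtn_insert cats0 // andbT.
rewrite drop_rcons ?(size_words Hw) // !(sorted_pairwise ltn_trans) pairwise_rcons.
suff -> : all (ltn^~ n) (drop t w) by [].
by apply/allP => x /mem_drop /(allP Hlt).
Qed.

Lemma count_sorted_tail_insert n t w : w \in words n -> t <= n ->
  count (sorted_tail t) [seq take i w ++ n :: drop i w | i <- iota 0 n.+1]
  = \sum_(i < t.+1) sorted_tail i w.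
Proof.
move=> Hw tn; have Hs := size_words Hw.
rewrite count_map -sumn_count sumnE big_map -{1}(subn0 n.+1) -/(index_iota 0 n.+1).
(* The final slot n supplies the summand of index t; the slots from t to n - 1 contribute
   nothing. *)
rewrite big_nat_recr // big_ord_recr /=; congr (_ + _); last first.
  by rewrite take_oversize ?drop_oversize ?Hs // cats1 sorted_tail_insert_last.
rewrite (big_cat_nat (n := t)) //= [X in _ + X]big_nat_cond [X in _ + X]big1 ?addn0.
  rewrite big_mkord; apply: eq_bigr => i _.
  by rewrite sorted_tail_insert ?ltn_ord // (leq_trans (ltn_ord i)).
by move=> i; rewrite andbT => /andP[ti iN]; rewrite sorted_tail_insert // ltnNge ti.
Qed.

Lemma sorted_tailS n t : t <= n ->
  count (sorted_tail t) (words n.+1) = \sum_(i < t.+1) count (sorted_tail i) (words n).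
Proof.
move=> tn; rewrite (seq.permP (perm_max_insertions n)) count_flatten sumnE !big_map.
rewrite big_seq (eq_bigr (fun w => \sum_(i < t.+1) sorted_tail i w)); last first.
  by move=> w Hw; apply: count_sorted_tail_insert.
rewrite -big_seq exchange_big /=; apply: eq_bigr => i _.
by rewrite -sumn_count sumnE big_map.
Qed.

(* The difference of binomials is the ballot number; the subtracted term is moved
   to the left to avoid truncated subtraction. *)
Lemma count_sorted_tail n t : t <= n ->
  count (sorted_tail t) (words n) + 'C(n + t, n.+1) = 'C(n + t, n).
Proof.
elim: n t => [|n IH] t; first by rewrite leqn0 => /eqP ->.
have H u : u <= n ->
    count (sorted_tail u) (words n.+1) + 'C(n + u.+1, n.+2) = 'C(n + u.+1, n.+1).
  move=> un; rewrite sorted_tailS //.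
  (* The partial sums of ballot numbers collapse by Pascal's rule. *)
  elim: u un => [|u IHu] un.
    rewrite big_ord1 addn1 bin_small // addn0 binn.
    by have := IH 0 (leq0n n); rewrite addn0 binn bin_small // addn0.
  rewrite big_ord_recr /= addnS !binS; have := IHu (ltnW un); have := IH _ un.
  by rewrite /= !addnS; lia.
rewrite leq_eqVlt => /orP[/eqP ->|]; last by rewrite ltnS addSnnS => /H.
(* A tail of one letter is as sorted as an empty one, so t = n + 1 reduces to t = n. *)
have -> : count (sorted_tail n.+1) (words n.+1) = count (sorted_tail n) (words n.+1).
  apply: eq_in_count => w Hw; rewrite /sorted_tail; congr (_ && _).
  have : size (drop n w) = 1 by rewrite size_drop (size_words Hw) subSnn.
  by rewrite (@drop_oversize _ n.+1) ?(size_words Hw) //; case: (drop n w) => [|x []].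
(* The symmetry C(2n+1, n+1) = C(2n+1, n) balances the terms that Pascal's rule adds to the two
   sides. *)
have := H n (leqnn n); have := bin_sub (leq_addr n.+1 n).
by rewrite addKn addSn !binS; lia.
Qed.

Lemma count_triple_free_gtn n : count (triple_free gtn) (words n) = catalan n.
Proof.
have -> : count (triple_free gtn) (words n) = count (sorted_tail n) (words n).
  apply: eq_in_count => w Hw; rewrite /sorted_tail drop_oversize ?andbT //.
  by rewrite (size_words Hw).
(* Since (n+1) C(2n, n+1) = n C(2n, n), the difference C(2n, n) - C(2n, n+1) is C(2n, n) / (n+1). *)
have := count_sorted_tail (leqnn n); have := mul_bin_left (n + n) n.
rewrite /catalan mul2n -addnn addnK => E1 E2.
have -> : 'C(n + n, n) = count (sorted_tail n) (words n) * n.+1 by nia.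
by rewrite mulnK.
Qed.

(** * The 123 case: at most two words survive *)

Definition drs123 (w : seq nat) : bool :=
  [&& triple_free ltn w, simsun_word w & simsun_word (inverse_word w)].

Lemma card_DRS123 n : #|DRS perm123 n| = count drs123 (words n).
Proof.
rewrite -card_word; apply: eq_card => s.
by rewrite !inE avoids123 !simsun_wordE word_inv.
Qed.

(** This is A_n; the other survivor B_(n+1) is [n :: staircase n]. *)
Fixpoint staircase (n : nat) : seq nat :=
  if n is m.+2 then [:: m, m.+1 & staircase m] else iota 0 n.

Lemma staircase_words n : staircase n \in words n.
Proof.
elim/ltn_ind: n => -[|[|n]] IH; [by rewrite mem_words | by rewrite mem_words |].
have H := words_insert (a := [::]) (IH n (ltnW (ltnSn _))).
exact: (words_insert (a := [:: n]) H).
Qed.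

Lemma cons_staircase_words n : n :: staircase n \in words n.+1.
Proof. exact: (words_insert (a := [::]) (staircase_words n)). Qed.

Lemma simsun_wordsP n w : w \in words n ->
  reflect (forall k, no_double_descent (subword k w)) (simsun_word w).
Proof. by move=> Hw; apply: simsun_wordP; rewrite (size_words Hw) words_lt. Qed.

Lemma simsun_inverseP n w : w \in words n ->
  reflect (forall k, no_double_descent (subword k (inverse_word w)))
          (simsun_word (inverse_word w)).
Proof.
move=> Hw; apply: simsun_wordP.
by rewrite size_inverse_word (size_words Hw) inverse_word_lt.
Qed.

Lemma subword_insert k n a b : k <= n -> subword k (a ++ n :: b) = subword k (a ++ b).
Proof. by move=> kn; rewrite /subword !filter_cat /= ltnNge kn. Qed.

Lemma subword_map_bump p k w :
  subword (bump p k) (map (bump p) w) = map (bump p) (subword k w).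
Proof.
rewrite /subword filter_map; congr map; apply: eq_filter => x /=.
by rewrite !ltnNge leq_bump2.
Qed.

Lemma bump_mono p : {mono bump p : x y / x < y}.
Proof. by move=> x y; rewrite !ltnNge leq_bump2. Qed.

(** For the inverse, deleting the maximum drops the last letter and closes a gap in the values. Up
    to increasing relabelling, each subword of the smaller inverse is thus a prefix of a subword of
    the larger one. *)
Lemma drs123_insert n a b : a ++ b \in words n ->
  drs123 (a ++ n :: b) -> drs123 (a ++ b).
Proof.
move=> Hw /and3P[Ht /(simsun_wordsP (words_insert Hw)) Hs].
move=> /(simsun_inverseP (words_insert Hw)) Hi; apply/and3P; split.
- have := triple_free_filter (gtn n) Ht; rewrite -[filter _ _]/(subword n _).
  by rewrite subword_insert // subword_all ?words_lt.
- apply/(simsun_wordsP Hw) => k; have [kn|nk] := leqP k n.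
    by rewrite -(subword_insert _ _ kn).
  have -> : subword k (a ++ b) = subword n (a ++ n :: b).
    rewrite subword_insert // !subword_all //; first exact: words_lt.
    by apply: sub_all (words_lt Hw) => x /=; lia.
  exact: Hs.
apply/(simsun_inverseP Hw) => k.
rewrite -(no_double_descent_mono _ (bump_mono (size a))) -subword_map_bump.
have := Hi (bump (size a) k); rewrite inverse_word_insert // -cats1.
by rewrite /subword filter_cat => /no_double_descent_catl.
Qed.

Lemma triple_free_ltn_ascent x y n a b : x < y -> y < n ->
  ~~ triple_free ltn [:: x, y & a ++ n :: b].
Proof.
move=> xy yn; rewrite /= negb_and; apply/orP; left; rewrite negb_and; apply/orP; left.
by apply/allPn; exists n; rewrite ?mem_cat ?inE ?eqxx ?orbT // xy yn.
Qed.

(* Any insertion of the new maximum other than the stated one creates a 123 with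
   the first ascent, or a double descent among the first five letters. *)
Lemma drs123_extension n w : 6 <= n -> w \in words n -> drs123 w ->
  w = staircase n \/ w = n.-1 :: staircase n.-1.
Proof.
move=> n6; rewrite -(subnKC n6); elim: (n - 6) w => {n n6} [|m IH] w.
  rewrite addn0 => Hw Hd.
  (* The base case checks all 720 words of size 6. *)
  have : all (fun w => drs123 w ==> ((w == staircase 6) || (w == 5 :: staircase 5)))
             (words 6) by vm_compute.
  by move=> /allP /(_ w Hw); rewrite Hd => /orP[] /eqP ->; [left|right].
rewrite addnS => Hw Hd; have [a [b [E Hab]]] := wordsS_split Hw.
have /and3P[Ht /(simsun_wordsP Hw) /(_ (6 + m).+1) Hs _] := Hd.
rewrite subword_all ?words_lt // in Hs.
move: Hd Ht Hs; rewrite {}E => Hd Ht Hs.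
have [Ea|Eb] := IH _ Hab (drs123_insert Hab Hd).
(* Into A: slot 0 gives B, slot 1 creates the descents 6+m, 5+m, 2+m, and later slots extend the
   ascent 4+m, 5+m. *)
- case: a Ea Ht Hs {Hw Hd Hab} => [|x [|y a]] /=.
  + by move=> ->; right.
  + by case=> -> -> _ /=; rewrite !ltnS; lia.
  + case=> -> -> _ H.
    have := @triple_free_ltn_ascent (4 + m) (5 + m) (6 + m) a b; rewrite /= H.
    by move=> /(_ (ltnSn _) (ltnSn _)).
(* Into B: slot 0 creates 6+m, 5+m, 3+m, slot 1 gives A, slot 2 creates 6+m, 4+m, 1+m, and later
   slots extend the ascent 3+m, 4+m. *)
- case: a Eb Ht Hs {Hw Hd Hab} => [|x [|y [|z a]]] /=.
  + by move=> -> _ /=; lia.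
  + by case=> -> ->; left.
  + by case=> -> -> -> _ /=; lia.
  + case=> -> -> -> _ /andP[_ H].
    have := @triple_free_ltn_ascent (3 + m) (4 + m) (6 + m) a b; rewrite /= H.
    by move=> /(_ (ltnSn _) (ltnW (ltnSn _))).
Qed.

(** * Both words satisfy the three conditions *)

Lemma pairwise_no_ascent n w : all (gtn n) w ->
  pairwise (fun y z => ~~ ((n < y) && (y < z))) w.
Proof.
elim: w => //= y w IH /andP[/= yn /IH ->]; rewrite andbT.
by apply/allP => z _; rewrite ltnNge (ltnW yn).
Qed.

Lemma triple_free_ltn_cons n w : all (gtn n) w ->
  triple_free ltn (n :: w) = triple_free ltn w.
Proof. by move=> Hw /=; rewrite pairwise_no_ascent. Qed.

Lemma triple_free_staircase n : triple_free ltn (staircase n).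
Proof.
elim/ltn_ind: n => -[|[|n]] IH //.
have Hlt := words_lt (staircase_words n).
have Hn : all (gtn n.+1) (staircase n) by apply: sub_all Hlt => x /=; lia.
have H : triple_free ltn (n.+1 :: staircase n) by rewrite triple_free_ltn_cons // IH.
apply/andP; split=> //; apply/andP; split; last exact: pairwise_no_ascent.
by apply/allP => z /(allP Hn) /=; lia.
Qed.

(** The two claims go together: cutting the leading pair at k = n + 1 leaves [n :: staircase n], an
    instance of the first claim. The ascent in each pair separates the rest. *)
Lemma staircase_no_double_descent n :
  (forall x, n <= x -> no_double_descent (x :: staircase n)) /\
  (forall k, no_double_descent (subword k (staircase n))).
Proof.
elim/ltn_ind: n => -[|[|n]] IH; first by split=> // -[].
  by split=> // -[].
have [IHx IHk] := IH n (ltnW (ltnSn _)).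
have Hlt := words_lt (staircase_words n).
have Hasc u : no_double_descent (rcons u n) ->
    no_double_descent (u ++ [:: n, n.+1 & staircase n]).
  by move=> Hu; rewrite no_double_descent_ascent // Hu IHx.
split=> [x _|k]; first exact: (Hasc [:: x]).
rewrite /subword /=; have [nk|kn] := ltnP n k; last by rewrite ltnNge (leqW kn); apply: IHk.
rewrite -/(subword k _) subword_all; last by apply: sub_all Hlt => x /=; lia.
by case: ifP => _; [apply: (Hasc [::]) | apply: IHx].
Qed.

Lemma inverse_cons_max n w : w \in words n ->
  inverse_word (n :: w) = rcons (map S (inverse_word w)) 0.
Proof. by move=> Hw; rewrite (inverse_word_insert (a := [::]) Hw). Qed.

Lemma inverse_staircaseSS n : inverse_word (staircase n.+2)
  = map (fun i => i.+2) (inverse_word (staircase n)) ++ [:: 0; 1].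
Proof.
rewrite (inverse_word_insert (a := [:: n]) (cons_staircase_words n)).
rewrite -[[:: n] ++ _]/(n :: _) (inverse_cons_max (staircase_words n)) map_rcons -!cats1 -catA -map_comp.
by congr (_ ++ _).
Qed.

(* The appended 0 makes the claim inductive: it says that every subword of the
   inverse ends with an ascent unless it has at most one letter. *)
Lemma inverse_staircase_no_double_descent n k :
  no_double_descent (rcons (map S (subword k (inverse_word (staircase n)))) 0).
Proof.
elim/ltn_ind: n k => -[|[|n]] IH k; [by [] | by case: k | ].
rewrite inverse_staircaseSS /subword filter_cat filter_map.
(* The shifted block has letters at least 2, so k < 2 leaves at most the letter 0. *)
have H0 j : j < 2 -> [seq x <- inverse_word (staircase n) | x.+2 < j] = [::].
  by move=> j2; rewrite -(@filter_pred0 _ (inverse_word (staircase n)));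
     apply: eq_filter => x /=; lia.
case: k => [|[|k]]; rewrite /preim /=; [by rewrite H0 | by rewrite H0 |].
rewrite map_cat rcons_cat -map_comp /= no_double_descent_ascent // andbT.
(* This map sends 0 to 1 and x+1 to x+3, turning the word of the induction hypothesis into the part
   that ends at the ascent's lower letter. *)
have Hf : {mono (fun x => (bump 1 x).+1) : x y / x < y}.
  by move=> x y; rewrite ltnS bump_mono.
have := IH n (ltnW (ltnSn _)) k; rewrite -(no_double_descent_mono _ Hf) map_rcons.
by rewrite -map_comp; congr (no_double_descent (rcons _ _)).
Qed.

Lemma drs123_staircase n : drs123 (staircase n).
Proof.
have Hw := staircase_words n; apply/and3P; split; first exact: triple_free_staircase.
  by apply/(simsun_wordsP Hw); case: (staircase_no_double_descent n).
apply/(simsun_inverseP Hw) => k; rewrite -(no_double_descent_mono (f := S)) //.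
have := inverse_staircase_no_double_descent n k.
by rewrite -cats1 => /no_double_descent_catl.
Qed.

(** The inverse of this word is the shifted inverse of [staircase n] followed by 0, so its nonempty
    subwords are literally those of [inverse_staircase_no_double_descent]. *)
Lemma drs123_cons_staircase n : drs123 (n :: staircase n).
Proof.
have Hw := cons_staircase_words n; have Hlt := words_lt (staircase_words n).
have [Hx Hk] := staircase_no_double_descent n; apply/and3P; split.
- by rewrite triple_free_ltn_cons // triple_free_staircase.
- apply/(simsun_wordsP Hw) => k; rewrite /subword /=; case: ifP => [nk|_]; last exact: Hk.
  rewrite -/(subword k _) subword_all; first exact: Hx.
  by apply: sub_all Hlt => x /=; lia.
apply/(simsun_inverseP Hw) => -[|k]; rewrite inverse_cons_max ?staircase_words //.
  by rewrite /subword filter_pred0.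
have := inverse_staircase_no_double_descent n k.
by rewrite -!cats1 /subword filter_cat filter_map.
Qed.

(** * Final counts *)

Lemma card_DRS123_large n : 6 <= n -> #|DRS perm123 n| = 2.
Proof.
case: n => // n n6; rewrite card_DRS123 -size_filter.
have Hp : perm_eq [seq w <- words n.+1 | drs123 w] [:: staircase n.+1; n :: staircase n].
  apply: uniq_perm; first by rewrite filter_uniq // permutations_uniq.
    by case: n n6 => // n _; rewrite /= inE andbT; apply/eqP => -[]; lia.
  move=> w; rewrite mem_filter !inE; apply/andP/orP => [[Hd Hw]|].
    by have [->|->] := drs123_extension n6 Hw Hd; rewrite eqxx; [left|right].
  case=> /eqP ->; split; rewrite ?drs123_staircase ?drs123_cons_staircase //.
    exact: staircase_words.
  exact: cons_staircase_words.
by rewrite (perm_size Hp).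
Qed.

Theorem theorem4p11 :
  (forall n : nat, 1 <= n -> #|DRS perm321 n| = catalan n) /\
  [/\ #|DRS perm123 4| = 5,
      #|DRS perm123 5| = 3 &
      forall n : nat, 6 <= n -> #|DRS perm123 n| = 2].
Proof.
split=> [n _|]; first by rewrite card_DRS321 count_triple_free_gtn.
split; [by rewrite card_DRS123; vm_compute | by rewrite card_DRS123; vm_compute |].
exact: card_DRS123_large.
Qed.
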